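(* Let $n\in\mathbb{N}$ and define $T_n$ on $L^2((0,\infty))$ by $$(T_nf)(x) := \frac{1}{x^n}\int_0^x\int_0^{t_1}\cdots\int_0^{t_{n-1}} f(u)\,du\,dt_{n-1}\cdots dt_1,\qquad x\in(0,\infty),\ f\in L^2((0,\infty)).$$ Then $T_n$ is a bounded linear operator on $L^2((0,\infty))$ with norm $\|T_n\| = 2^n/(2n-1)!!$.
   Context: $(2n-1)!!=(2n-1)(2n-3)\cdots 3\cdot 1$. *)

(* Defs.v *)
From HB Require Import structures.
From mathcomp Require Import all_boot all_order all_algebra.
From mathcomp Require Import all_classical all_reals all_analysis.
Set Implicit Arguments. Unset Strict Implicit. Unset Printing Implicit Defensive.
Import Order.TTheory GRing.Theory Num.Theory.
Local Open Scope classical_set_scope.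
Local Open Scope ring_scope.

(* (2n-1)!! = (2n-1)(2n-3)...3.1, with the empty product (-1)!! = 1 for n = 0 *)
Fixpoint odd_dfact (n : nat) : nat :=
  match n with
  | 0 => 1
  | k.+1 => (2 * k + 1) * odd_dfact k
  end.

Section Defs.
Variable R : realType.

Definition posR : set R := `]0%R, +oo[%classic.

Definition L2pos (f : R -> R) : Prop :=
  measurable_fun posR f /\
  (\int[@lebesgue_measure R]_(x in posR) ((`|f x| ^+ 2)%:E) < +oo)%E.

Definition L2norm (f : R -> R) : R :=
  Num.sqrt (fine (\int[@lebesgue_measure R]_(x in posR) ((`|f x| ^+ 2)%:E))).

Fixpoint iter_int (n : nat) (f : R -> R) : R -> R :=
  match n with
  | 0 => f
  | k.+1 => fun x => Rintegral (@lebesgue_measure R) `[0%R, x] (iter_int k f)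
  end.

Definition Tn (n : nat) (f : R -> R) : R -> R :=
  fun x => (x ^+ n)^-1 * iter_int n f x.

End Defs.

(* Main.v *)
(** Writing F_k for the k-fold iterated integral of f, the bound
    |T_n f| <= 2^n/(2n-1)!! |f| is a telescoping product of the weighted Hardy
    inequalities  int F_{k+1}^2 x^{-2k-2} <= (k+1/2)^{-2} int F_k^2 x^{-2k},
    each obtained from Cauchy-Schwarz with the weight u^{k-1/2} and Tonelli.
    The constant is sharp because x^{e-1/2} restricted to (0,1] is, on (0,1],
    an eigenfunction of T_n with eigenvalue 1/prod_{j<n}(j+1/2+e), which tends
    to 2^n/(2n-1)!! as e -> 0. *)
Require Import Defs.
From HB Require Import structures.
From mathcomp Require Import all_boot all_order all_algebra.
From mathcomp Require Import all_classical all_reals all_analysis.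
From mathcomp Require Import measurable_realfun ring lra.
Import Order.TTheory GRing.Theory Num.Theory.
Import numFieldNormedType.Exports.
Local Open Scope classical_set_scope.
Local Open Scope ring_scope.

(** * Calculus of real powers on the positive half-line *)

Lemma derivable_powR_pos (R : realType) (s x : R) : 0 < x ->
  derivable (@powR R ^~ s) x 1.
Proof. by move=> x0; apply: derivable_powR; rewrite in_itv/= x0. Qed.

Lemma continuous_powR_pos (R : realType) (s x : R) : 0 < x ->
  {for x, continuous (@powR R ^~ s)}.
Proof.
by move=> x0; apply: differentiable_continuous; apply/derivable1_diffP/derivable_powR_pos.
Qed.

Lemma derive1_powR_div (R : realType) (s x : R) : s != 0 -> 0 < x ->
  (fun t : R => t `^ s / s)^`()%classic x = x `^ (s - 1).
Proof.
move=> s0 x0.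
rewrite derive1Mr; last exact: derivable_powR_pos.
by rewrite powR_derive1 ?in_itv/= ?x0// mulrAC divff// mul1r.
Qed.

Lemma derivable_powR_div (R : realType) (s x : R) : 0 < x ->
  derivable (fun t : R => t `^ s / s) x 1.
Proof.
move=> x0; apply: derivableM; first exact: derivable_powR_pos.
exact: derivable_cst.
Qed.

Lemma continuous_powR_div (R : realType) (s x : R) : 0 < x ->
  {for x, continuous (fun t : R => t `^ s / s)}.
Proof.
by move=> x0; apply: differentiable_continuous; apply/derivable1_diffP/derivable_powR_div.
Qed.

Lemma integral_powR_cc (R : realType) (s a b : R) : s != 0 -> 0 < a -> a < b ->
  (\int[@lebesgue_measure R]_(x in `[a, b]) (x `^ (s - 1))%:E)%E =
  ((b `^ s - a `^ s) / s)%:E.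
Proof.
move=> s0 a0 ab.
rewrite (@continuous_FTC2 R _ (fun t => t `^ s / s))//.
- by rewrite -EFinB mulrBl.
- apply: continuous_in_subspaceT => x; rewrite inE/= in_itv/= => /andP[ax _].
  by apply: continuous_powR_pos; exact: lt_le_trans ax.
- split.
  + move=> x; rewrite in_itv/= => /andP[ax _].
    by apply: derivable_powR_div; exact: lt_trans ax.
  + by apply: cvg_at_right_filter; exact: continuous_powR_div.
  + by apply: cvg_at_left_filter; apply: continuous_powR_div; exact: lt_trans ab.
- move=> x; rewrite in_itv/= => /andP[ax _].
  by rewrite derive1_powR_div//; exact: lt_trans ax.
Qed.

Lemma cvg_powRN_pinfty (R : realType) (s : R) : 0 < s ->
  x `^ (- s) @[x --> +oo%R] --> (0 : R).
Proof.
move=> s0; apply/cvgrPdist_lt => e e0; near=> x.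
(* The threshold solves [x^(-s) = e]. *)
have ex : (e^-1) `^ (s^-1) < x by near: x; apply: nbhs_pinfty_gt; rewrite num_real.
have x0 : 0 < x by apply: le_lt_trans ex; exact: powR_ge0.
rewrite sub0r normrN ger0_norm ?powR_ge0// powRN invf_plt ?posrE ?powR_gt0//.
have := @gt0_ltr_powR _ s s0 _ _ _ _ ex.
rewrite -powRrM mulVf ?gt_eqF// powRr1 ?invr_ge0 ?ltW//; apply.
  by rewrite nnegrE powR_ge0.
by rewrite nnegrE ltW.
Unshelve. all: by end_near. Qed.

(** For [s < 1] the integrand is unbounded at 0, so the fundamental theorem of calculus is applied
    on compact intervals away from 0, and monotone convergence exhausts []0, b]]. *)
Lemma integral_powR_oc0 (R : realType) (s b : R) : 0 < s -> 0 < b ->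
  (\int[@lebesgue_measure R]_(x in `]0%R, b]) (x `^ (s - 1))%:E)%E =
  (b `^ s / s)%:E.
Proof.
move=> s0 b0.
(* With [i.+2] the left end is strictly below [b] already for [i = 0], as [integral_powR_cc]
   demands. *)
pose F i : set R := `[b / i.+2%:R, b]%classic.
have bi i : 0 < b / i.+2%:R < b.
  rewrite divr_gt0//= ltr_pdivrMr// -[ltLHS]mulr1 ltr_pM2l//.
  by rewrite (_ : 1 = 1%:R)// ltr_nat.
have -> : `]0%R, b]%classic = \bigcup_i F i.
  apply/seteqP; split=> x /=.
    rewrite in_itv/= => /andP[x0 xb].
    exists (Num.bound (b / x)) => //.
    rewrite /F/= in_itv/= xb andbT ler_pdivrMr// mulrC -ler_pdivrMr//.
    apply: (le_trans (ltW (archi_boundP _))); first by rewrite divr_ge0// ltW.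
    by rewrite ler_nat -addn2 leq_addr.
  move=> [i _]; rewrite /F/= !in_itv/= => /andP[h ->]; rewrite andbT.
  by apply: lt_le_trans h; case/andP: (bi i).
have mF i : measurable (F i) by exact: measurable_itv.
have cvgb : (((b `^ s - (b / i.+2%:R) `^ s) / s)%:E @[i --> \oo] --> (b `^ s / s)%:E)%E.
  apply: cvg_EFin; first by near=> i.
  have -> : fine \o (fun i : nat => ((b `^ s - (b / i.+2%:R) `^ s) / s)%:E) =
      (fun i => (b `^ s - b `^ s * i.+2%:R `^ (- s)) / s).
    by apply/funext => i /=; rewrite powRM ?invr_ge0 ?ltW// -powR_inv1// -powRrM mulN1r.
  have -> : b `^ s / s = (b `^ s - b `^ s * 0) / s by rewrite mulr0 subr0.
  apply: cvgM; last exact: cvg_cst.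
  apply: cvgB; first exact: cvg_cst.
  apply: cvgM; first exact: cvg_cst.
  have h : (i.+2%:R : R) @[i --> \oo] --> +oo%R.
    rewrite (cvg_shiftS (fun i : nat => i.+1%:R : R)) (cvg_shiftS (fun i : nat => i%:R : R)).
    exact: cvgr_idn.
  exact: (cvg_comp _ _ h (@cvg_powRN_pinfty R s s0)).
have cvgF : (\int[@lebesgue_measure R]_(x in F i) (x `^ (s - 1))%:E @[i --> \oo] -->
    \int[@lebesgue_measure R]_(x in \bigcup_i F i) (x `^ (s - 1))%:E)%E.
apply: ge0_nondecreasing_set_cvg_integral => //.
- move=> i j ij; apply/subsetPset => x; rewrite /F/= !in_itv/= => /andP[h ->].
  rewrite andbT; apply: le_trans h.
  by rewrite ler_pM2l// lef_pV2 ?posrE// ler_nat !ltnS.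
- move=> i; apply/measurable_EFinP; apply: measurable_funTS.
  exact: measurable_powR.
- by move=> i x _; rewrite lee_fin powR_ge0.
have E : (fun i => \int[@lebesgue_measure R]_(x in F i) (x `^ (s - 1))%:E)%E =
    (fun i : nat => ((b `^ s - (b / i.+2%:R) `^ s) / s)%:E).
  by apply/funext => i; have /andP[? ?] := bi i; rewrite integral_powR_cc ?gt_eqF.
by move: cvgF; rewrite E => cvgF; apply: (cvg_unique _ cvgF cvgb).
Unshelve. all: by end_near. Qed.

Lemma integral_powR_cy (R : realType) (s a : R) : 0 < s -> 0 < a ->
  (\int[@lebesgue_measure R]_(x in `[a, +oo[) (x `^ (- s - 1))%:E)%E =
  (a `^ (- s) / s)%:E.
Proof.
move=> s0 a0.
rewrite (@ge0_continuous_FTC2y R _ (fun t => t `^ (- s) / (- s)) a 0).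
- by rewrite sub0e -EFinN invrN mulrN opprK.
- by move=> x _; exact: powR_ge0.
- apply: continuous_in_subspaceT => x; rewrite inE/= in_itv/= andbT => ax.
  by apply: continuous_powR_pos; exact: lt_le_trans ax.
- rewrite -(mul0r (- s)^-1); apply: cvgM; last exact: cvg_cst.
  exact: cvg_powRN_pinfty.
- by move=> x ax; apply: derivable_powR_div; exact: lt_trans ax.
- by apply: cvg_at_right_filter; exact: continuous_powR_div.
- move=> x; rewrite in_itv/= andbT => ax.
  by rewrite derive1_powR_div ?oppr_eq0 ?gt_eqF//; exact: lt_trans ax.
Qed.

(** * Local integrability and iterated integrals *)

(** Primitives of a square-integrable function need not be square-integrable, so inductions on the
    number of integrations run in this larger class. For negative [x] the interval is empty and the
    condition is void. *)
Definition locally_integrable0 {R : realType} (g : R -> R) : Prop :=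
  forall x : R, (@lebesgue_measure R).-integrable `[0%R, x] (EFin \o g).

Lemma posR_measurable_itv {R : realType} (g : R -> R) (x : R) :
  measurable_fun (@posR R) g -> measurable_fun `[0%R, x] g.
Proof.
move=> /measurable_fun_itv_obnd_cbndP mg; apply: measurable_funS mg => //.
by apply: subset_itvl.
Qed.

Lemma locally_integrable0_measurable {R : realType} (g : R -> R) :
  locally_integrable0 g -> measurable_fun (@posR R) g.
Proof.
move=> ig; have : measurable_fun (\bigcup_i `[0%R, i%:R : R]%classic) g.
  apply/measurable_fun_bigcup => i; first exact: measurable_itv.
  by have /integrableP[/measurable_EFinP] := ig i%:R.
apply: measurable_funS; first by apply: bigcup_measurable => i _; exact: measurable_itv.
move=> x; rewrite /posR/= in_itv/= andbT => x0; exists (Num.bound x) => //=.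
by rewrite in_itv/= (ltW x0)/= ltW// archi_boundP// ltW.
Qed.

(** On an interval of finite length it suffices that [|f| <= |f|^2 + 1], which follows from
    [(|f| - 1)^2 >= 0]. *)
Lemma L2pos_locally_integrable0 {R : realType} (f : R -> R) :
  L2pos f -> locally_integrable0 f.
Proof.
move=> [mf foo] x.
have mfx := posR_measurable_itv f x mf.
have sub : `]0%R, x]%classic `<=` @posR R by exact: subset_itvl.
have mfo : measurable_fun `]0%R, x] f by apply: measurable_funS mf => //; exact: measurable_itv.
apply/integrableP; split; first exact/measurable_EFinP.
rewrite -integral_itv_obnd_cbnd; last first.
  by apply: measurableT_comp => //; exact/measurable_EFinP.
have mf2 : measurable_fun `]0%R, x] (fun t => (`|f t| ^+ 2)%:E).
  apply/measurable_EFinP; apply: measurable_funX; exact: measurableT_comp.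
apply: (@le_lt_trans _ _ (\int[lebesgue_measure]_(t in `]0%R, x]) ((`|f t| ^+ 2)%:E + 1%:E))%E).
  apply: ge0_le_integral => //.
  - by apply: measurableT_comp => //; exact/measurable_EFinP.
  - by apply: emeasurable_funD => //.
  - move=> t _ /=; rewrite -EFinD lee_fin.
    by have := sqr_ge0 (`|f t| - 1); have := normr_ge0 (f t); nra.
rewrite ge0_integralD//.
apply: lte_add_pinfty.
  apply: le_lt_trans foo; apply: ge0_subset_integral => //; first exact: measurable_itv.
  apply/measurable_EFinP; apply: measurable_funX; exact: measurableT_comp.
rewrite integral_cst//= mul1e lebesgue_measure_itv/=.
by case: ifPn => _; rewrite ?ltry.
Qed.

(** The primitive of an integrable function is continuous on [[0, x]], hence integrable on that
    compact interval. *)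
Lemma Rintegral_locally_integrable0 {R : realType} (g : R -> R) :
  locally_integrable0 g ->
  locally_integrable0 (fun x => Rintegral (@lebesgue_measure R) `[0%R, x] g).
Proof.
move=> ig x; have [x0|x0] := leP 0 x.
  apply: continuous_compact_integrable; first exact: segment_compact.
  exact: parameterized_integral_continuous.
by rewrite set_itv_ge ?bnd_simp -?ltNge//; exact: integrable_set0.
Qed.

Lemma iter_int_locally_integrable0 {R : realType} (k : nat) (f : R -> R) :
  locally_integrable0 f -> locally_integrable0 (iter_int k f).
Proof. by move=> lf; elim: k => [//|k ih] /=; exact: Rintegral_locally_integrable0. Qed.

Lemma locally_integrable0_linear {R : realType} (f g : R -> R) (a b : R) :
  locally_integrable0 f -> locally_integrable0 g ->
  locally_integrable0 (fun u => a * f u + b * g u).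
Proof.
move=> lf lg x.
apply: (integrableD _ (integrableZl _ a (lf x)) (integrableZl _ b (lg x)));
  exact: measurable_itv.
Qed.

Lemma eq_Rintegral_pos {R : realType} (f g : R -> R) (x : R) :
  measurable_fun (@posR R) f -> measurable_fun (@posR R) g ->
  {in `]0%R, x], f =1 g} ->
  Rintegral (@lebesgue_measure R) `[0%R, x] f = Rintegral (@lebesgue_measure R) `[0%R, x] g.
Proof.
move=> mf mg fg.
have S (h : R -> R) : measurable_fun (@posR R) h -> measurable_fun `]0%R, x] (EFin \o h).
  move=> mh; apply/measurable_EFinP; move: mh.
  by apply: measurable_funS; [exact: measurable_itv|exact: subset_itvl].
rewrite /Rintegral -(integral_itv_obnd_cbnd (S _ mf)) -(integral_itv_obnd_cbnd (S _ mg)).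
by congr fine; apply: eq_integral => t; rewrite inE => /fg /= ->.
Qed.

Lemma iter_int_linear {R : realType} (f g : R -> R) (a b : R) (k : nat) (x : R) :
  locally_integrable0 f -> locally_integrable0 g -> 0 < x ->
  iter_int k (fun u => a * f u + b * g u) x = a * iter_int k f x + b * iter_int k g x.
Proof.
move=> lf lg.
elim: k x => [//|k ih] x x0 /=.
have lFf := iter_int_locally_integrable0 k f lf.
have lFg := iter_int_locally_integrable0 k g lg.
transitivity (Rintegral (@lebesgue_measure R) `[0%R, x]
    (fun u => a * iter_int k f u + b * iter_int k g u)).
  apply: eq_Rintegral_pos.
  - apply: locally_integrable0_measurable; apply: iter_int_locally_integrable0.
    exact: locally_integrable0_linear.
  - by apply: locally_integrable0_measurable; exact: locally_integrable0_linear.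
  - by move=> t; rewrite in_itv/= => /andP[t0 _]; exact: ih.
rewrite RintegralD//.
- by rewrite !RintegralZl.
- by apply: integrableZl (lFf x); exact: measurable_itv.
- by apply: integrableZl (lFg x); exact: measurable_itv.
Qed.

(** * The weighted Hardy inequality *)

(** Cauchy-Schwarz for the splitting of [g] into [g u^((1-s)/2)] times [u^((s-1)/2)]: the square of
    the second factor has integral [x^s / s] over []0, x]]. The integral on the right may be
    infinite. *)
Lemma sqr_Rintegral_le {R : realType} (s x : R) (g : R -> R) :
  0 < s -> 0 < x -> locally_integrable0 g ->
  (((Rintegral (@lebesgue_measure R) `[0%R, x] g) ^+ 2)%:E <=
   (x `^ s / s)%:E *
   \int[@lebesgue_measure R]_(u in `]0%R, x]) (g u ^+ 2 * u `^ (1 - s))%:E)%E.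
Proof.
move=> s0 x0 lg.
have mg := locally_integrable0_measurable g lg.
have mgx : measurable_fun `]0%R, x] g.
  by apply: measurable_funS mg; [exact: measurable_itv|exact: subset_itvl].
have mp p : measurable_fun `]0%R, x] (fun u : R => u `^ p).
  by apply: measurable_funTS; exact: measurable_powR.
have mg2w : measurable_fun `]0%R, x] (fun u => g u ^+ 2 * u `^ (1 - s)).
  by apply: measurable_funM => //; exact: measurable_funX.
have mgn : measurable_fun `]0%R, x] (fun u => `|g u|) by exact: measurableT_comp.
set B := x `^ s / s.
have B0 : 0 < B by rewrite divr_gt0// powR_gt0.
set A := (\int[_]_(u in _) _)%E.
have A0 : (0 <= A)%E.
  by apply: integral_ge0 => u _; rewrite lee_fin mulr_ge0 ?sqr_ge0 ?powR_ge0.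
set I := Rintegral (@lebesgue_measure R) `[0%R, x] (fun u => `|g u|).
have gI : `|Rintegral (@lebesgue_measure R) `[0%R, x] g| <= I.
  by apply: le_normr_Rintegral; [exact: measurable_itv|exact: lg].
(* The vanishing case is set aside because the optimal parameter [B / I] needs [I > 0]. *)
have [->|I0] := eqVneq (Rintegral (@lebesgue_measure R) `[0%R, x] g) 0.
  by rewrite expr0n/= mule_ge0// lee_fin ltW.
have {}I0 : 0 < I by apply: lt_le_trans gI; rewrite normr_gt0.
apply: (@le_trans _ _ (I ^+ 2)%:E).
  by rewrite lee_fin -real_normK ?num_real// lerXn2r ?nnegrE// ltW.
have IE : I%:E = (\int[@lebesgue_measure R]_(u in `]0%R, x]) (`|g u|)%:E)%E.
  have /integrableP[mgE goo] := lg x.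
  rewrite integral_itv_obnd_cbnd; last first.
    exact/measurable_EFinP.
  rewrite /I /Rintegral fineK// ge0_fin_numE; first exact: goo.
  by apply: integral_ge0 => u _; rewrite lee_fin.
(* AM-GM: 2 |g| <= t g^2 w + 1 / (t w) for the weight w = u^(1-s); the
   optimal choice t = B / I turns this into I^2 <= B A. *)
have key t : 0 < t -> ((2 * I)%:E <= t%:E * A + (t^-1 * B)%:E)%E.
  move=> t0.
  have -> : (2 * I)%:E = (\int[@lebesgue_measure R]_(u in `]0%R, x]) (2 * `|g u|)%:E)%E.
    rewrite EFinM IE -ge0_integralZl_EFin//.
    exact/measurable_EFinP.
  have -> : (t%:E * A = \int[@lebesgue_measure R]_(u in `]0%R, x])
      (t * (g u ^+ 2 * u `^ (1 - s)))%:E)%E.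
    rewrite /A -ge0_integralZl_EFin ?ltW//.
    - by move=> u _; rewrite lee_fin mulr_ge0 ?sqr_ge0 ?powR_ge0.
    - exact/measurable_EFinP.
  have -> : ((t^-1 * B)%:E = \int[@lebesgue_measure R]_(u in `]0%R, x])
      (t^-1 * u `^ (s - 1))%:E)%E.
    rewrite EFinM /B -integral_powR_oc0// -ge0_integralZl_EFin ?invr_ge0 ?ltW//.
    - by move=> u _; rewrite lee_fin powR_ge0.
    - by apply/measurable_EFinP; exact: mp.
  have mphi : measurable_fun `]0%R, x] (fun u => t * (g u ^+ 2 * u `^ (1 - s))).
    by apply: measurable_funM => //; exact: mp.
  have mw : measurable_fun `]0%R, x] (fun u => t^-1 * u `^ (s - 1)).
    by apply: measurable_funM => //; exact: mp.
  have phi0 u : 0 <= t * (g u ^+ 2 * u `^ (1 - s)).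
    by apply: mulr_ge0 (ltW t0) _; apply: mulr_ge0; rewrite ?sqr_ge0 ?powR_ge0.
  have w0 u : 0 <= t^-1 * u `^ (s - 1) by apply: mulr_ge0; rewrite ?powR_ge0 ?invr_ge0 ?(ltW t0).
  rewrite -ge0_integralD//; last 4 first.
  - by move=> u _; rewrite lee_fin.
  - exact/measurable_EFinP.
  - by move=> u _; rewrite lee_fin.
  - exact/measurable_EFinP.
  apply: ge0_le_integral => //.
  - apply/measurable_EFinP; exact: measurable_funM.
  - by apply: emeasurable_funD; exact/measurable_EFinP.
  - move=> u; rewrite /= in_itv/= => /andP[u0 _]; rewrite -EFinD lee_fin.
    have w0u : 0 < u `^ (1 - s) by exact: powR_gt0.
    have -> : u `^ (s - 1) = (u `^ (1 - s))^-1 :> R by rewrite -powRN opprB.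
    rewrite -(real_normK (num_real (g u))).
    (* Multiplied by [t w], the claim reads [2 y <= y^2 + 1] with [y = t w |g u|]. *)
    have := sqr_ge0 (t * u `^ (1 - s) * `|g u| - 1).
    have tw : 0 < t * u `^ (1 - s) by exact: mulr_gt0.
    move=> h; rewrite -(ler_pM2l tw).
    have -> : t * u `^ (1 - s) * (t * (`|g u| ^+ 2 * u `^ (1 - s)) + t^-1 / u `^ (1 - s)) =
      (t * u `^ (1 - s) * `|g u|) ^+ 2 + 1 by field; rewrite !gt_eqF.
    by move: h; rewrite sqrrB1; lra.
have [Afin|] := boolP (A \is a fin_num); last first.
  rewrite ge0_fin_numE// -leNgt leye_eq => /eqP ->.
  by rewrite gt0_muley ?lte_fin// leey.
have := key (B / I); rewrite divr_gt0// => /(_ isT).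
rewrite -(fineK Afin) -!EFinM -EFinD !lee_fin invf_div.
(* Multiplying by [I] gives [2 I^2 <= B A + I^2]. *)
move=> h; have : I * (2 * I) <= I * (B / I * fine A + I / B * B) by rewrite ler_pM2l.
have -> : I * (B / I * fine A + I / B * B) = B * fine A + I ^+ 2.
  by field; rewrite !gt_eqF.
by rewrite expr2; lra.
Qed.

Lemma measurable_weighted_sqr {R : realType} (p : R) (g : R -> R) (D : set R) :
  measurable_fun D g -> measurable_fun D (fun u => g u ^+ 2 * u `^ p).
Proof.
move=> mg; apply: measurable_funM; first exact: measurable_funX.
by apply: measurable_funTS; exact: measurable_powR.
Qed.

(** By [sqr_Rintegral_le] the left integrand is at most [x^(-s-1) / s] times the integral of
    [g^2 u^(1-s)] over []0, x]]. Tonelli on the region [u <= x] leaves the inner integral of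
    [x^(-s-1)] over [[u, +oo[], which is [u^(-s) / s]; the two factors [1/s] make up the
    constant. *)
Lemma weighted_hardy {R : realType} (s : R) (g : R -> R) :
  0 < s -> locally_integrable0 g ->
  (\int[@lebesgue_measure R]_(x in @posR R)
     ((Rintegral (@lebesgue_measure R) `[0%R, x] g) ^+ 2 * x `^ (- (2 * s) - 1))%:E <=
   (s ^- 2)%:E *
   \int[@lebesgue_measure R]_(u in @posR R) (g u ^+ 2 * u `^ (1 - 2 * s))%:E)%E.
Proof.
move=> s0 lg.
have mpos : measurable (@posR R) by exact: measurable_itv.
have posP x : (x \in @posR R) = (0 < x).
  by apply/idP/idP; rewrite inE /posR /= in_itv/= andbT.
have mg := locally_integrable0_measurable g lg.
have mG := locally_integrable0_measurable _ (Rintegral_locally_integrable0 _ lg).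
(* Extension by zero turns the double integral over the region [0 < u <= x] into one over the whole
   plane, where Tonelli is applied. *)
pose phi : R -> R := (fun u => g u ^+ 2 * u `^ (1 - s)) \_ (@posR R).
pose psi : R -> R := (fun x => x `^ (- s - 1) / s) \_ (@posR R).
have phi0 u : 0 <= phi u.
  by rewrite /phi patchE; case: ifPn => // _; apply: mulr_ge0; rewrite ?sqr_ge0 ?powR_ge0.
have psi0 x : 0 <= psi x.
  rewrite /psi patchE; case: ifPn => // _.
  by apply: mulr_ge0; rewrite ?powR_ge0 ?invr_ge0 ?(ltW s0).
have mphi : measurable_fun setT phi.
  apply: (measurable_restrictT (fun u => g u ^+ 2 * u `^ (1 - s)) mpos).1.
  exact: measurable_weighted_sqr.
have mpsi : measurable_fun setT psi.
  apply: (measurable_restrictT (fun x => x `^ (- s - 1) / s) mpos).1; apply: measurable_funM => //.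
  by apply: measurable_funTS; exact: measurable_powR.
pose tri : set (R * R) := [set z | z.2 <= z.1].
have mtri : measurable tri.
  rewrite -[tri]setTI; apply: measurable_fun_le => //.
pose h (z : R * R) : \bar R := (psi z.1 * (phi z.2 * \1_tri z))%:E.
have h0 z : (0 <= h z)%E by rewrite lee_fin !mulr_ge0.
have mh : measurable_fun setT h.
  apply/measurable_EFinP; apply: measurable_funM.
    by apply: measurableT_comp.
  apply: measurable_funM; first exact: measurableT_comp.
  exact: measurable_indic.
have triE x u : \1_tri (x, u) = (u <= x)%R%:R :> R.
  by rewrite indicE mem_setE.
have innerx x : (@posR R) x -> (\int[@lebesgue_measure R]_u h (x, u) =
    (x `^ (- s - 1) / s)%:E *
    \int[@lebesgue_measure R]_(u in `]0%R, x]) (g u ^+ 2 * u `^ (1 - s))%:E)%E.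
  move=> x0; have psix : psi x = x `^ (- s - 1) / s by rewrite /psi patchE mem_set.
  rewrite -psix [in RHS]integral_mkcond -ge0_integralZl_EFin//; last 2 first.
  - by move=> u _; rewrite patchE; case: ifP => // _; rewrite lee_fin mulr_ge0 ?sqr_ge0 ?powR_ge0.
  - apply/(measurable_restrictT _ _).1; first exact: measurable_itv.
    apply/measurable_EFinP; apply: measurable_weighted_sqr.
    by apply: measurable_funS mg; [exact: measurable_itv|exact: subset_itvl].
  apply: eq_integral => u _; rewrite /h/= EFinM; congr (_ * _)%E.
  rewrite /phi !patchE posP triE mem_setE in_itv/=.
  by case: (0 < u) => /=; rewrite ?mul0r//; case: (u <= x); rewrite ?mulr1 ?mulr0.
have inneru u : (@posR R) u -> (\int[@lebesgue_measure R]_x h (x, u) =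
    (s ^- 2 * (g u ^+ 2 * u `^ (1 - 2 * s)))%:E)%E.
  rewrite /posR/= in_itv/= andbT => u0.
  transitivity ((phi u / s)%:E * \int[@lebesgue_measure R]_(x in `[u, +oo[) (x `^ (- s - 1))%:E)%E.
    rewrite [in RHS]integral_mkcond.
    rewrite -ge0_integralZl_EFin ?mulr_ge0 ?invr_ge0 ?(ltW s0)//; last 2 first.
    - by move=> x _; rewrite patchE; case: ifP => // _; rewrite lee_fin powR_ge0.
    - apply/(measurable_restrictT _ _).1; first exact: measurable_itv.
      by apply/measurable_EFinP; apply: measurable_funTS; exact: measurable_powR.
    apply: eq_integral => x _; rewrite /h/= patchE mem_setE in_itv/= andbT triE.
    case: leP => ux; last by rewrite !mulr0 mule0.
    rewrite /psi patchE posP (lt_le_trans u0 ux) -EFinM; rewrite mulr1; congr EFin; ring.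
  rewrite integral_powR_cy// -EFinM; congr EFin.
  rewrite /phi patchE posP u0.
  have -> : 1 - 2 * s = (1 - s) + - s by ring.
  rewrite (@powRD _ u (1 - s) (- s)) ?(gt_eqF u0) ?implybT//.
  by field; rewrite gt_eqF.
have mF : measurable_fun setT (fun x => \int[@lebesgue_measure R]_u h (x, u))%E.
  exact: (measurable_fun_fubini_tonelli_F (m2 := @lebesgue_measure R) h mh h0).
apply: (@le_trans _ _ (\int[@lebesgue_measure R]_x \int[@lebesgue_measure R]_u h (x, u))%E).
  apply: (@le_trans _ _ (\int[@lebesgue_measure R]_(x in @posR R)
      \int[@lebesgue_measure R]_u h (x, u))%E).
    apply: ge0_le_integral => //.
    - by move=> x _; rewrite lee_fin mulr_ge0 ?sqr_ge0 ?powR_ge0.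
    - apply/measurable_EFinP; exact: measurable_weighted_sqr.
    - exact: measurable_funTS.
    - move=> x x0; rewrite innerx//.
      have {}x0 : 0 < x by move: x0; rewrite /posR/= in_itv/= andbT.
      rewrite EFinM muleC.
      apply: (le_trans (lee_wpmul2l _ (sqr_Rintegral_le s x g s0 x0 lg))).
        by rewrite lee_fin powR_ge0.
      rewrite muleA -EFinM.
      (* One factor [x^(-s)] of the weight cancels the [x^s] produced by Cauchy-Schwarz. *)
      have -> : - (2 * s) - 1 = (- s - 1) + - s by ring.
      rewrite (@powRD _ x (- s - 1) (- s)) ?(gt_eqF x0) ?implybT// [x `^ (- s)]powRN.
      have xs : x `^ s != 0 by rewrite gt_eqF// powR_gt0.
      have -> // : x `^ (- s - 1) / x `^ s * (x `^ s / s) = x `^ (- s - 1) / s.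
      by field; rewrite xs gt_eqF.
  apply: ge0_subset_integral => //.
  by move=> x _; exact: integral_ge0.
rewrite (fubini_tonelli (m1 := @lebesgue_measure R) (m2 := @lebesgue_measure R) h mh h0).
rewrite -ge0_integralZl_EFin//; last 3 first.
- by move=> u _; rewrite lee_fin mulr_ge0 ?sqr_ge0 ?powR_ge0.
- by apply/measurable_EFinP; exact: measurable_weighted_sqr.
- by rewrite invr_ge0 sqr_ge0.
rewrite [leRHS]integral_mkcond le_eqVlt; apply/orP; left; apply/eqP.
apply: eq_integral => u _; rewrite patchE; case: ifPn => pu.
  by rewrite inneru ?EFinM//; exact: set_mem.
(* For [u] outside the half-line [phi u = 0], so both sides vanish. *)
rewrite integral0_eq// => x _.
by rewrite /h/= /phi patchE (negbTE pu) mul0r mulr0.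
Qed.

(** * The upper bound for the norm of [Tn] *)

Lemma measurable_Tn {R : realType} (n : nat) (f : R -> R) :
  L2pos f -> measurable_fun (@posR R) (Tn n f).
Proof.
move=> /L2pos_locally_integrable0 lf.
apply: (@eq_measurable_fun _ _ _ _ _ (fun x => x `^ (- n%:R) * iter_int n f x)).
  move=> x; rewrite inE /posR/= in_itv/= andbT => x0.
  by rewrite powR_invn// ltW.
apply: measurable_funM; first by apply: measurable_funTS; exact: measurable_powR.
by apply: locally_integrable0_measurable; exact: iter_int_locally_integrable0.
Qed.

(** Puts the squared integrand into the form on which [weighted_hardy] acts. *)
Lemma sqr_TnE {R : realType} (n : nat) (f : R -> R) (x : R) : 0 < x ->
  `|Tn n f x| ^+ 2 = iter_int n f x ^+ 2 * x `^ (- (2 * n)%:R).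
Proof.
move=> x0; rewrite real_normK ?num_real// /Tn exprMn mulrC powR_invn ?(ltW x0)//.
by rewrite exprVn -exprM mulnC.
Qed.

Lemma odd_dfact_neq0 {R : realType} (n : nat) : (odd_dfact n)%:R != 0 :> R.
Proof. by rewrite pnatr_eq0; elim: n => //= n ih; rewrite muln_eq0 addn1. Qed.

(** The new factor [2 / (2n+1)] is [1 / (n + 1/2)], the square root of the Hardy constant at
    [s = n + 1/2]. *)
Lemma odd_dfact_ratioS {R : realType} (n : nat) :
  2 ^+ n.+1 / (odd_dfact n.+1)%:R = 2 ^+ n / (odd_dfact n)%:R / (n%:R + 2^-1) :> R.
Proof.
have dn := @odd_dfact_neq0 R n.
have n0 : (2 * n%:R + 1 : R) != 0 by rewrite gt_eqF// ltr_wpDl// mulr_ge0.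
have -> : (odd_dfact n.+1)%:R = (2 * n%:R + 1) * (odd_dfact n)%:R :> R.
  by rewrite /= natrM natrD natrM.
by rewrite exprS; field; rewrite dn mulrC n0.
Qed.

Lemma integral_sqr_Tn_le {R : realType} (n : nat) (f : R -> R) : L2pos f ->
  (\int[@lebesgue_measure R]_(x in @posR R) (`|Tn n f x| ^+ 2)%:E <=
   ((2 ^+ n / (odd_dfact n)%:R) ^+ 2)%:E *
   \int[@lebesgue_measure R]_(x in @posR R) (`|f x| ^+ 2)%:E)%E.
Proof.
move=> L2f; have lf := L2pos_locally_integrable0 f L2f.
have E k : (\int[@lebesgue_measure R]_(x in @posR R) (`|Tn k f x| ^+ 2)%:E =
    \int[@lebesgue_measure R]_(x in @posR R)
      (iter_int k f x ^+ 2 * x `^ (- (2 * k)%:R))%:E)%E.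
  apply: eq_integral => x; rewrite inE /posR/= in_itv/= andbT => x0.
  by rewrite sqr_TnE.
elim: n => [|n ih].
  rewrite expr0 divr1 expr1n mul1e le_eqVlt; apply/orP; left; apply/eqP.
  by apply: eq_integral => x _; rewrite /Tn expr0 invr1 mul1r.
(* This [s] makes the two Hardy exponents [-2(n+1)] and [-2n], the weights belonging to [Tn n.+1 f]
   and [Tn n f]. *)
pose s : R := n%:R + 2^-1.
have s0 : 0 < s by rewrite /s ltr_wpDl// invr_gt0.
have := weighted_hardy s (iter_int n f) s0 (iter_int_locally_integrable0 n f lf).
have -> : - (2 * s) - 1 = - (2 * n.+1)%:R.
  by rewrite natrM -natr1 /s; field.
have -> : 1 - 2 * s = - (2 * n)%:R by rewrite natrM /s; field.
rewrite E => /le_trans; apply; rewrite -E.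
apply: (le_trans (lee_wpmul2l _ ih)); first by rewrite lee_fin invr_ge0 sqr_ge0.
rewrite muleA -EFinM.
have -> // : s ^- 2 * (2 ^+ n / (odd_dfact n)%:R) ^+ 2 =
    (2 ^+ n.+1 / (odd_dfact n.+1)%:R) ^+ 2 :> R.
by rewrite odd_dfact_ratioS -/s [RHS]exprMn exprVn mulrC.
Qed.

(** * Sharpness: almost extremal functions *)

Lemma cvg_prod_shift {R : realType} (n : nat) :
  (fun e : R => \prod_(j < n) (e + j%:R + 2^-1)) @ (0 : R) -->
  \prod_(j < n) ((0 : R) + j%:R + 2^-1).
Proof.
elim: n => [|n ih].
  by under eq_fun do rewrite big_ord0; rewrite big_ord0; exact: cvg_cst.
under eq_fun do rewrite big_ord_recr/=.
rewrite big_ord_recr/=; apply: cvgM => //.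
by apply: cvgD; [apply: cvgD; [exact: cvg_id|exact: cvg_cst]|exact: cvg_cst].
Qed.

(** Identifies the limiting eigenvalue; the summand 0 is kept so that the product matches the limit
    in [cvg_prod_shift]. *)
Lemma prod_half_odd {R : realType} (n : nat) :
  (\prod_(j < n) (0 + j%:R + 2^-1))^-1 = 2 ^+ n / (odd_dfact n)%:R :> R.
Proof.
elim: n => [|n ih]; first by rewrite big_ord0 expr0 mul1r.
by rewrite big_ord_recr/= invfM ih odd_dfact_ratioS add0r.
Qed.

(** The exponent [-1/2] is critical for square integrability at 0. A positive [e] moves it just
    inside the admissible range, and the cut at 1 removes the tail. *)
Definition trunc_powR {R : realType} (e : R) : R -> R :=
  (fun x => x `^ (e - 2^-1)) \_ `]0%R, 1%R].

Lemma measurable_trunc_powR {R : realType} (e : R) : measurable_fun setT (trunc_powR e).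
Proof.
apply: (measurable_restrictT (fun x => x `^ (e - 2^-1)) _).1; first exact: measurable_itv.
by apply: measurable_funTS; exact: measurable_powR.
Qed.

Lemma integral_sqr_trunc_powR {R : realType} (e : R) : 0 < e ->
  (\int[@lebesgue_measure R]_(x in @posR R) (`|trunc_powR e x| ^+ 2)%:E = ((2 * e)^-1)%:E)%E.
Proof.
move=> e0; have e20 : 0 < 2 * e by rewrite mulr_gt0.
have := @integral_powR_oc0 R (2 * e) 1 e20 ltr01; rewrite powR1 mul1r => <-.
rewrite integral_mkcond [RHS]integral_mkcond; apply: eq_integral => x _.
rewrite !patchE !mem_setE /posR /trunc_powR !in_itv/= andbT patchE mem_setE in_itv/=.
case: ltP => //= x0; case: leP => //= x1; last by rewrite normr0 expr0n.
congr EFin; rewrite ger0_norm ?powR_ge0// -powR_mulrn ?powR_ge0// -powRrM.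
by congr (_ `^ _); field.
Qed.

Lemma L2pos_trunc_powR {R : realType} (e : R) : 0 < e -> L2pos (trunc_powR e).
Proof.
move=> e0; split; first by apply: measurable_funTS; exact: measurable_trunc_powR.
by rewrite integral_sqr_trunc_powR// ltry.
Qed.

(** For [x <= 1] the integrals see only the pure power, and each integration raises the exponent by
    one and divides by the new exponent [e + k + 1/2]. *)
Lemma iter_int_trunc_powR {R : realType} (e : R) (k : nat) (x : R) :
  0 < e -> 0 < x <= 1 ->
  iter_int k (trunc_powR e) x =
  x `^ (e - 2^-1 + k%:R) / \prod_(j < k) (e + j%:R + 2^-1).
Proof.
move=> e0; elim: k x => [|k ih] x /andP[x0 x1].
  by rewrite big_ord0 divr1 addr0 /trunc_powR /= patchE mem_setE in_itv/= x0 x1.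
set P := \prod_(j < k) (e + j%:R + 2^-1) in ih *.
have s0 : 0 < e + k%:R + 2^-1 by rewrite addr_gt0 ?invr_gt0// ltr_wpDr.
have lf := L2pos_locally_integrable0 _ (L2pos_trunc_powR e e0).
rewrite /=.
transitivity (Rintegral (@lebesgue_measure R) `[0%R, x]
    (fun u => P^-1 * u `^ (e + k%:R + 2^-1 - 1))).
  apply: eq_Rintegral_pos.
  - by apply: locally_integrable0_measurable; exact: iter_int_locally_integrable0.
  - by apply: measurable_funM => //; apply: measurable_funTS; exact: measurable_powR.
  - move=> t; rewrite in_itv/= => /andP[t0 tx].
    rewrite ih ?t0 ?(le_trans tx)//= mulrC; congr (_ * _ `^ _); by field.
rewrite /Rintegral -integral_itv_obnd_cbnd; last first.
  apply/measurable_EFinP; apply: measurable_funM => //.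
  by apply: measurable_funTS; exact: measurable_powR.
have P0 : 0 <= P by apply: prodr_ge0 => j _; rewrite !addr_ge0 ?invr_ge0 ?ler0n// ltW.
under eq_integral do rewrite EFinM.
rewrite ge0_integralZl_EFin ?invr_ge0//; last 2 first.
- by move=> u _; rewrite lee_fin powR_ge0.
- by apply/measurable_EFinP; apply: measurable_funTS; exact: measurable_powR.
rewrite integral_powR_oc0//= big_ord_recr/= -/P invfM.
have -> : e - 2^-1 + k.+1%:R = e + k%:R + 2^-1 by rewrite -natr1; field.
by ring.
Qed.

(** The comparison is pointwise: on []0, 1]] the function is an eigenfunction, and beyond 1 it
    vanishes while its image contributes a nonnegative amount. *)
Lemma L2norm_Tn_trunc_powR {R : realType} (e : R) (n : nat) : 0 < e ->
  (\prod_(j < n) (e + j%:R + 2^-1))^-1 * L2norm (trunc_powR e) <=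
  L2norm (Tn n (trunc_powR e)).
Proof.
move=> e0; set P := \prod_(j < n) _.
have P0 : 0 <= P by apply: prodr_ge0 => j _; rewrite !addr_ge0 ?invr_ge0 ?ler0n// ltW.
have L2f := L2pos_trunc_powR e e0.
rewrite /L2norm -[P^-1]ger0_norm ?invr_ge0// -sqrtr_sqr -sqrtrM ?sqr_ge0//.
apply: ler_wsqrtr.
have := integral_sqr_Tn_le n _ L2f; set TT := (\int[_]_(x in _) (`|Tn _ _ _| ^+ 2)%:E)%E.
rewrite integral_sqr_trunc_powR// -EFinM => TTle.
have TT0 : (0 <= TT)%E by apply: integral_ge0 => x _; rewrite lee_fin sqr_ge0.
(* Finiteness matters because [fine] sends [+oo] to 0, which would ruin a lower bound; it comes from
   the upper bound already proved. *)
have TTfin : TT \is a fin_num by rewrite ge0_fin_numE// (le_lt_trans TTle)// ltry.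
rewrite -lee_fin fineK// EFinM fineK//= -(integral_sqr_trunc_powR e e0).
rewrite -ge0_integralZl_EFin ?sqr_ge0//; last 2 first.
- exact: measurable_itv.
- apply/measurable_EFinP/measurable_funX/measurableT_comp => //.
  by apply: measurable_funTS; exact: measurable_trunc_powR.
apply: ge0_le_integral.
- exact: measurable_itv.
- by move=> x _; rewrite lee_fin mulr_ge0 ?sqr_ge0.
- apply/measurable_EFinP; apply: measurable_funM => //.
  apply: measurable_funX; apply: measurableT_comp => //.
  by apply: measurable_funTS; exact: measurable_trunc_powR.
- apply/measurable_EFinP; apply: measurable_funX; apply: measurableT_comp => //.
  exact: measurable_Tn.
move=> x; rewrite /posR/= in_itv/= andbT => x0; rewrite lee_fin.
have [x1|x1] := leP x 1; last first.
  by rewrite /trunc_powR patchE mem_setE in_itv/= x0 (lt_geF x1)/= normr0 expr0n mulr0 sqr_ge0.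
rewrite /Tn iter_int_trunc_powR ?x0// -/P.
rewrite /trunc_powR patchE mem_setE in_itv/= x0 x1/=.
rewrite (@powRD _ x (e - 2^-1) n%:R) ?(gt_eqF x0) ?implybT// powR_mulrn ?(ltW x0)//.
rewrite le_eqVlt; apply/orP; left; apply/eqP.
have xn : x ^+ n != 0 by rewrite expf_neq0// gt_eqF.
have -> : (x ^+ n)^-1 * (x `^ (e - 2^-1) * x ^+ n / P) = P^-1 * x `^ (e - 2^-1).
  by rewrite [_ * x ^+ n]mulrC -mulrA mulKf// mulrC.
by rewrite normrM exprMn [`|P^-1|]ger0_norm// invr_ge0.
Qed.

(** * Boundedness, linearity and the exact norm *)

Theorem theorem7p1 (R : realType) (n : nat) (hn : (1 <= n)%N) :
  let C : R := 2 ^+ n / (odd_dfact n)%:R in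
  (* T_n maps L^2((0,oo)) into itself *)
  (forall f : R -> R, L2pos f -> L2pos (Tn n f)) /\
  (* T_n is linear *)
  (forall (f g : R -> R) (a b : R), L2pos f -> L2pos g ->
     forall x : R, posR x -> Tn n (fun u => a * f u + b * g u) x = a * Tn n f x + b * Tn n g x) /\
  (* T_n is bounded with ||T_n|| <= C *)
  (forall f : R -> R, L2pos f -> L2norm (Tn n f) <= C * L2norm f) /\
  (* and C is the least such bound, i.e. ||T_n|| = C *)
  (forall c : R, c < C ->
     exists f : R -> R, L2pos f /\ c * L2norm f < L2norm (Tn n f)).
Proof.
move=> C; have C0 : 0 <= C by rewrite divr_ge0// exprn_ge0.
have TL2 (f : R -> R) : L2pos f -> L2pos (Tn n f).
  move=> L2f; split; first exact: measurable_Tn.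
  apply: (le_lt_trans (integral_sqr_Tn_le n f L2f)).
  by apply: lte_mul_pinfty; rewrite ?lee_fin ?sqr_ge0//; case: L2f.
split=> //; split; [|split].
- move=> f g a b /L2pos_locally_integrable0 lf /L2pos_locally_integrable0 lg x.
  rewrite /posR/= in_itv/= andbT => x0.
  by rewrite /Tn iter_int_linear//; ring.
- move=> f L2f.
  rewrite /L2norm -[C]ger0_norm// -sqrtr_sqr -sqrtrM ?sqr_ge0//.
  have fin (h : R -> R) : L2pos h ->
      (\int[@lebesgue_measure R]_(x in @posR R) (`|h x| ^+ 2)%:E)%E \is a fin_num.
    move=> [_ hoo]; rewrite ge0_fin_numE//.
    by apply: integral_ge0 => x _; rewrite lee_fin sqr_ge0.
  apply: ler_wsqrtr; rewrite -lee_fin EFinM !fineK ?fin//; last exact: TL2.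
  exact: integral_sqr_Tn_le.
- move=> c cC.
  (* The limit is taken from the right, since the test functions are square-integrable for
     [e > 0]. *)
  have : \forall e \near (0 : R)^'+, c < (\prod_(j < n) (e + j%:R + 2^-1))^-1.
    have P0 : \prod_(j < n) (0 + j%:R + 2^-1) != 0 :> R.
      by apply/prodf_neq0 => j _; rewrite gt_eqF// add0r ltr_wpDl// invr_gt0.
    have := cvgV P0 (cvg_at_right_filter (@cvg_prod_shift R n)).
    by rewrite prod_half_odd => H; exact: (cvgr_gt _ (H _) _ cC).
  move=> /(fun H => filter_ex (filterI H (nbhs_right_gt 0))) [e [ce e0]].
  exists (trunc_powR e); split; first exact: L2pos_trunc_powR.
  apply: lt_le_trans (L2norm_Tn_trunc_powR e n e0).
  (* Strictness survives because the test function has positive norm, its square being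
     [1 / (2e)]. *)
  rewrite ltr_pM2r// /L2norm integral_sqr_trunc_powR//= sqrtr_gt0.
  by rewrite invr_gt0 mulr_gt0.
Qed.
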